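(* Let $\Gamma_1$ and $\Gamma_2$ be two finitely presented strongly connected blueprints that are quasi-isometric. Then $\Gamma_1$ admits a (nonempty) strongly aperiodic SFT if and only if $\Gamma_2$ admits a (nonempty) strongly aperiodic SFT.
   Context: **Blueprints.** A blueprint $\Gamma=(M,S,\mathfrak{i},\mathfrak{t},R)$ (also written $(M,S,R)$) consists of a nonempty set $M$ of states (with $\varnothing\notin M$), a nonempty set $S$ of generators, maps $\mathfrak{i}\colon S\to M$ and $\mathfrak{t}\colon S\to\mathcal{P}(M)\setminus\{\varnothing\}$, and a set $R\subseteq S^*\times S^*$ of relations ($S^*$ is the set of finite words over $S$, $\varepsilon$ the empty word). It is finitely presented if $M,S,R$ are finite. A word $w_1\cdots w_n\in S^*$ is $\Gamma$-consistent if it is empty or $\mathfrak{i}(w_{i+1})\in\mathfrak{t}(w_i)$ for $1\le i<n$. Two $\Gamma$-consistent words $u,v$ are $\Gamma$-similar if $u=xwy$, $v=xw'y$ for some $(w,w')\in R$ and $x,y\in S^*$; $\Gamma$-equivalence is the equivalence relation on $\Gamma$-consistent words generated by $\Gamma$-similarity, and $\underline{w}_\Gamma$ denotes the class of $w$. **Models.** A map $\varphi\colon S^*\to M\cup\{\varnothing\}$ is $\Gamma$-consistent if $\varphi(\varepsilon)\in M$ and for all $w\in S^*$, $s\in S$: if $\mathfrak{i}(s)=\varphi(w)$ then $\varphi(ws)\in\mathfrak{t}(s)$, and if $\mathfrak{i}(s)\ne\varphi(w)$ then $\varphi(ws)=\varnothing$. Put $\operatorname{supp}(\varphi)=\{w:\varphi(w)\neq\varnothing\}$.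 A $\Gamma$-model is a $\Gamma$-consistent map $\varphi$ with $\varphi(u)=\varphi(v)$ for all $\Gamma$-equivalent $u,v\in\operatorname{supp}(\varphi)$. $\mathcal{M}(\Gamma)$ is the set of models. **Model graphs and quasi-isometry.** The model graph $G(\Gamma,\varphi)$ is the directed labeled graph with vertices $\underline{w}_\Gamma$, $w\in\operatorname{supp}(\varphi)$, and edges $(\underline{w}_\Gamma,\underline{ws}_\Gamma,s)$ for $w\in\operatorname{supp}(\varphi)$, $s\in S$, $\mathfrak{i}(s)=\varphi(w)$. $\Gamma$ is strongly connected if every model graph is strongly connected; then each model graph carries the quasi-metric (a metric except possibly for symmetry) $\rho(x,y)$ = length of a shortest directed path from $x$ to $y$. A map $f\colon X\to Y$ of quasi-metric spaces is a quasi-isometry if there are $C,D\ge0$, $\lambda\ge1$ with $\frac1\lambda\rho_X(x,y)-C\le\rho_Y(f(x),f(y))\le\lambda\rho_X(x,y)+C$ for all $x,y\in X$, and for every $z\in Y$ some $x\in X$ with $\max\{\rho_Y(z,f(x)),\rho_Y(f(x),z)\}\le D$. Two spaces are quasi-isometric if there is a quasi-isometry between them. Two strongly connected blueprints $\Gamma_1,\Gamma_2$ are quasi-isometric if $G(\Gamma_1,\varphi_1)$ and $G(\Gamma_2,\varphi_2)$ are quasi-isometric for all $\varphi_1\in\mathcal{M}(\Gamma_1)$, $\varphi_2\in\mathcal{M}(\Gamma_2)$. **Subshifts.** Let $A$ be a finite alphabet not containing $\varnothing$. A pattern is a map $p\colon S^*\to(M\times A)\cup\{\varnothing\}$ with finite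 support $\operatorname{supp}(p)=\{u:p(u)\ne\varnothing\}$. For a set $\mathcal{F}$ of patterns and $\varphi\in\mathcal{M}(\Gamma)$, $X[\Gamma,\varphi,\mathcal{F}]$ is the set of $x\in(A\cup\{\varnothing\})^{S^*}$ such that (s1) $\operatorname{supp}(x)=\operatorname{supp}(\varphi)$; (s2) $x(u)=x(v)$ for all $\Gamma$-equivalent $u,v\in\operatorname{supp}(\varphi)$; (s3) for every $p\in\mathcal{F}$ and $w\in\operatorname{supp}(\varphi)$ there is $u\in\operatorname{supp}(p)$ with $(\varphi(wu),x(wu))\ne p(u)$. Put $X[\Gamma,\mathcal{F}]=\{(\varphi,x):\varphi\in\mathcal{M}(\Gamma),\,x\in X[\Gamma,\varphi,\mathcal{F}]\}$; sets of this form are the $\Gamma$-subshifts, and such a set is a $\Gamma$-SFT (an SFT on $\Gamma$) when $\mathcal{F}$ can be chosen finite. For $w\in\operatorname{supp}(\varphi)$, $(\varphi,x)\cdot w$ is the pair of maps $u\mapsto\varphi(wu)$, $u\mapsto x(wu)$. **Strong aperiodicity.** A $\Gamma$-subshift $X$ is strongly aperiodic if for every $(\varphi,x)\in X$ and $w\in\operatorname{supp}(\varphi)$, $(\varphi,x)\cdot w=(\varphi,x)$ implies $\underline{w}_\Gamma=\underline{\varepsilon}_\Gamma$.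
   Formalization: Two hypotheses are added, as the claim fails without them: one blueprint has a model iff the other does, and for maps φ respecting the relations on supp(φ), Γ-equivalent words of supp(φ) are joined by Γ-similarities inside supp(φ). *)

(* Defs.v *)
From HB Require Import structures.
From Stdlib Require Export Relation_Operators.
From mathcomp Require Export all_boot all_order all_algebra.
From mathcomp Require Export boolp classical_sets functions cardinality reals.

Set Implicit Arguments.
Unset Strict Implicit.
Unset Printing Implicit Defensive.

Import Order.TTheory GRing.Theory Num.Theory.
Local Open Scope classical_set_scope.

Record lgraph (L : Type) := LGraph {
  vertex : Type;
  edge : vertex -> vertex -> L -> Prop }.

Section Graphs.
Variables (L : Type) (G : lgraph L).

Definition walk (n : nat) (x y : vertex G) : Prop :=
  exists p : seq (vertex G),
    [/\ size p = n,
        path (fun a b => `[< exists s, edge a b s >]) x p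
      & last x p = y].

Definition strongly_connected_graph : Prop :=
  forall x y : vertex G, exists n, walk n x y.

(* Takes the junk value 0 when there is no walk from x to y. *)
Definition dist (x y : vertex G) : nat :=
  xget 0%N [set n | walk n x y /\ forall m, walk m x y -> (n <= m)%N].

End Graphs.

Section QuasiIsometry.
Local Open Scope ring_scope.
Variables (R : realType) (X Y : Type) (dX : X -> X -> R) (dY : Y -> Y -> R).

Definition is_quasi_isometry (f : X -> Y) : Prop :=
  exists C D lam : R,
    [/\ 0 <= C, 0 <= D, 1 <= lam,
        forall x y, lam^-1 * dX x y - C <= dY (f x) (f y) <= lam * dX x y + C
      & forall z, exists x, Num.max (dY z (f x)) (dY (f x) z) <= D].

Definition quasi_isometric : Prop := exists f : X -> Y, is_quasi_isometry f.

End QuasiIsometry.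

Record blueprint := Blueprint {
  state : Type;
  gen : Type;
  state_neq0 : [set: state] !=set0;
  gen_neq0 : [set: gen] !=set0;
  ini : gen -> state;
  ter : gen -> set state;
  ter_neq0 : forall s, ter s !=set0;
  rels : set (seq gen * seq gen) }.
Arguments rels : clear implicits.

Definition finitely_presented (Gam : blueprint) : Prop :=
  [/\ finite_set [set: state Gam], finite_set [set: gen Gam]
    & finite_set (rels Gam)].

Section Blueprints.
Variable Gam : blueprint.
Local Notation M := (state Gam).
Local Notation S := (gen Gam).
Local Notation word := (seq S).

Definition consistent (w : word) : Prop :=
  sorted (fun s s' => `[< ter s (ini s') >]) w.

Definition similar (u v : word) : Prop :=
  [/\ consistent u, consistent v
    & exists x y r r', [/\ rels Gam (r, r'), u = x ++ r ++ y & v = x ++ r' ++ y]].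

(* On words that are not consistent this is plain equality; the words of the
   support of a consistent map are all consistent. *)
Definition equivalent : word -> word -> Prop := clos_refl_sym_trans word similar.

Definition wclass (w : word) : set word := [set v | equivalent w v].

(* A map to T with an added element, the empty set, is a map to option T, with
   None for the added element. *)
Definition supp (T : Type) (f : word -> option T) : set word :=
  [set w | f w <> None].

Definition consistent_map (phi : word -> option M) : Prop :=
  phi [::] <> None /\
  forall w s,
    (phi w = Some (ini s) -> exists2 m, ter s m & phi (rcons w s) = Some m) /\
    (phi w <> Some (ini s) -> phi (rcons w s) = None).

Definition models : set (word -> option M) :=
  [set phi | consistent_map phi /\
     forall u v, supp phi u -> supp phi v -> equivalent u v -> phi u = phi v].

Definition model_graph (phi : word -> option M) : lgraph S :=
  @LGraph S (set_type [set wclass w | w in supp phi])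
    (fun a b s => exists w,
       [/\ supp phi w, phi w = Some (ini s),
           \val a = wclass w & \val b = wclass (rcons w s)]).

Definition strongly_connected : Prop :=
  forall phi, models phi -> strongly_connected_graph (model_graph phi).

Definition rho (R : realType) (phi : word -> option M)
  (x y : vertex (model_graph phi)) : R := ((dist x y)%:R)%R.

(* A generator may have several terminal states, so a chain of similar consistent
   words can leave the support of a consistent map and come back to it. In that
   way finitely many relations can identify words of the support that finitely
   many identifications inside the support would keep apart. The condition below
   excludes this: if phi takes equal values at similar words of its support, then
   equivalent words of the support are joined by similarities inside the support.
   It always holds when there is only one state, since then every word is in the
   support. *)

Definition supp_similar (phi : word -> option M) (u v : word) : Prop :=
  [/\ supp phi u, supp phi v & similar u v].

Definition locally_presented : Prop :=
  forall phi, consistent_map phi ->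
    (forall u v, supp_similar phi u v -> phi u = phi v) ->
    forall u v, supp phi u -> supp phi v -> equivalent u v ->
      clos_refl_sym_trans word (supp_similar phi) u v.

Section Subshifts.
Variable A : Type.

Definition config : Type := ((word -> option M) * (word -> option A))%type.

Definition pattern : set (word -> option (M * A)) :=
  [set p | finite_set (supp p)].

Definition fiber_subshift (phi : word -> option M)
  (F : set (word -> option (M * A))) : set (word -> option A) :=
  [set x | [/\ supp x = supp phi,
      forall u v, supp phi u -> supp phi v -> equivalent u v -> x u = x v
    & forall p w, F p -> supp phi w ->
        exists u m a, p u = Some (m, a) /\
          (phi (w ++ u), x (w ++ u)) <> (Some m, Some a)]].

Definition subshift (F : set (word -> option (M * A))) : set config :=
  [set c | models c.1 /\ fiber_subshift c.1 F c.2].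

Definition is_SFT (X : set config) : Prop :=
  exists F, [/\ F `<=` pattern, finite_set F & X = subshift F].

Definition shift (c : config) (w : word) : config :=
  (fun u => c.1 (w ++ u), fun u => c.2 (w ++ u)).

Definition strongly_aperiodic (X : set config) : Prop :=
  forall c w, X c -> supp c.1 w -> shift c w = c -> wclass w = wclass [::].

End Subshifts.

Definition admits_strongly_aperiodic_SFT : Prop :=
  exists (A : finType) (X : set (config A)),
    [/\ is_SFT X, X !=set0 & strongly_aperiodic X].

End Blueprints.

Arguments models : clear implicits.
Arguments supp_similar {Gam} phi u v.
Arguments rho {Gam} R phi.

Definition quasi_isometric_blueprints (R : realType) (Gam1 Gam2 : blueprint)
    : Prop :=
  forall phi1 phi2, models Gam1 phi1 -> models Gam2 phi2 ->
    quasi_isometric (rho R phi1) (rho R phi2).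

(* Main.v *)
(** Let [X] be a strongly aperiodic SFT on [G] with a point [(psi, x)], let [phi]
    be a model of [H] and let [g] be a quasi-isometry from the graph of [psi] to
    the graph of [phi]. Over each vertex [v] of the graph of [phi] we record the
    points of the fibre of [g] over [v]: for each of them its state, its letter
    and, for each generator of [G], the bounded displacement in [H] that leads to
    its successor. Local rules on such records on an arbitrary model of [H] force
    the following of displacements to decode to points of [X]; this uses that
    relations of [G] close up locally and that [G] is locally presented. Further
    local rules make every vertex lie near a recorded point and make nearby
    recorded points reachable from one another by decoded words of [G].

    If [w] is a period of such a configuration, let [p] be a recorded point near
    the origin. Its translate by [w] decodes to the same point of [X] as [p], and
    it is reached from [p] by a word [a] of [G]; so [a] is a period of a point of
    [X], hence [a] is trivial, the translate is [p] itself and [w] is trivial.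
    Here the points of one fibre carry distinct labels, so that the endpoint of
    [a] is the translate itself and not merely a point near it. *)

From HB Require Import structures.
Require Import Defs.
From mathcomp Require Import zify lra.

Set Implicit Arguments.
Unset Strict Implicit.
Unset Printing Implicit Defensive.

Import Order.TTheory GRing.Theory Num.Theory.
Local Open Scope classical_set_scope.

(** * Words and model graphs as groupoids *)

Section FiniteType.
Variables (T : Type) (finT : finite_set [set: T]).

(** The finiteness proof is an argument so that this alias of [T] can carry a [finType] structure
    built from it. *)
Definition fin_of of finite_set [set: T] := T.

Lemma finite_pcancel : exists n (e : T -> 'I_n) (d : 'I_n -> option T), pcancel e d.
Proof.
have [n /card_set_bijP[f [fun_f inj_f _]]] := finT.
have f_lt x : (f x < n)%N by exact: (fun_f x I).
pose e x := Ordinal (f_lt x).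
pose d i := if pselect (exists x, e x = i) is left h then Some (projT1 (cid h)) else None.
exists n, e, d => x; rewrite /d; case: pselect => [h|[]]; last by exists x.
by case: cid => y /= [/inj_f] ->//; rewrite in_setT.
Qed.

Let n := projT1 (cid finite_pcancel).
Let e_ex := projT2 (cid finite_pcancel).
Let e := projT1 (cid e_ex).
Let d_ex := projT2 (cid e_ex).
Let eK : pcancel e (projT1 (cid d_ex)) := projT2 (cid d_ex).

HB.instance Definition _ := Finite.copy (fin_of finT) (pcan_type eK).
End FiniteType.

(** The classical structure on [T] allows picking witnesses in an arbitrary type. *)
Definition some_in T (x0 : T) (P : set T) : T := @xget {classic T} x0 P.

Lemma some_inP T (x0 : T) (P : set T) : P !=set0 -> P (some_in x0 P).
Proof. exact: (@xgetPex {classic T}). Qed.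

(** * Equivalence of words inside the support of a model *)

Section Words.
Variable Gam : blueprint.
Local Notation word := (seq (gen Gam)).
Implicit Types (phi : word -> option (state Gam)) (u v w t : word).

Definition ashift phi w : word -> option (state Gam) := fun u => phi (w ++ u).

Lemma equivalent_refl u : equivalent u u. Proof. exact: rst_refl. Qed.
Lemma equivalent_sym u v : equivalent u v -> equivalent v u.
Proof. exact: rst_sym. Qed.
Lemma equivalent_trans v u w : equivalent u v -> equivalent v w -> equivalent u w.
Proof. exact: rst_trans. Qed.

Lemma wclass_eq u v : wclass u = wclass v <-> equivalent u v.
Proof.
split=> [e|uv].
  by have := equivalent_refl v; rewrite -[equivalent v v]/(wclass v v) -e.
apply/seteqP; split=> w /=; apply: equivalent_trans => //; exact: equivalent_sym.
Qed.

Lemma supp_rconsP phi u s : consistent_map phi ->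
  supp phi (rcons u s) <-> phi u = Some (ini s).
Proof.
move=> [_ /(_ u s)[h1 h2]]; split; rewrite /supp /=.
  by move=> h; case: (pselect (phi u = Some (ini s))) => // /h2.
by move=> /h1[m _ ->].
Qed.

Lemma supp_prefix phi u t : consistent_map phi -> supp phi (u ++ t) -> supp phi u.
Proof.
move=> cphi; elim/last_ind: t => [|t s IH]; first by rewrite cats0.
by rewrite -rcons_cat => /(supp_rconsP _ _ cphi) e; apply: IH; rewrite /supp /= e.
Qed.

Lemma supp_consistent phi u : consistent_map phi -> supp phi u -> consistent u.
Proof.
move=> cphi; elim/last_ind: u => [//|u s' IH].
move=> /(supp_rconsP _ _ cphi) e; have {IH} := IH.
case/lastP: u e => // u s e IH.
have {}IH : consistent (rcons u s) by apply: IH; rewrite /supp /= e.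
have : supp phi (rcons u s) by rewrite /supp /= e.
move=> /(supp_rconsP _ _ cphi) e'.
have [m tm] := (cphi.2 u s).1 e'.
rewrite e => -[em]; move: tm; rewrite -em => tm.
move: IH; rewrite /consistent; case: u {e e'} => [_|s0 u] /=.
  by rewrite andbT; apply/asboolP.
by rewrite (rcons_path _ s0 (rcons u s)) last_rcons => ->; apply/asboolP.
Qed.

Lemma ashift_consistent phi w : consistent_map phi -> supp phi w ->
  consistent_map (ashift phi w).
Proof.
move=> [_ c] pw; split; first by rewrite /ashift cats0.
by move=> u s; rewrite /ashift -rcons_cat; apply: c.
Qed.

(** Equal states at [u] and [v] admit the same next generator, so one extension stays in the support
    exactly when the other does; the appended letters only lengthen the right context of the
    similarity. *)
Lemma cat_similar phi u v t : models _ phi -> supp_similar phi u v ->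
  supp phi (u ++ t) \/ supp phi (v ++ t) -> supp_similar phi (u ++ t) (v ++ t).
Proof.
move=> [cphi mphi] [su sv suv].
have eqv u' v' : supp_similar phi u' v' -> phi u' = phi v'.
  by move=> [? ? ?]; apply: mphi => //; exact: rst_step.
elim/last_ind: t => [|t s IH]; first by rewrite !cats0.
rewrite -!rcons_cat !supp_rconsP// => h.
have /IH h1 : supp phi (u ++ t) \/ supp phi (v ++ t)
  by case: h => e; [left|right]; rewrite /supp /= e.
have e := eqv _ _ h1.
have su' : supp phi (rcons (u ++ t) s)
  by apply/supp_rconsP => //; move: h; rewrite e => -[].
have sv' : supp phi (rcons (v ++ t) s)
  by apply/supp_rconsP => //; move: h; rewrite e => -[].
split=> //; case: suv => [cu cv [x [y [r [r' [rr eu ev]]]]]].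
split; [exact: supp_consistent su'|exact: supp_consistent sv'|].
by exists x, (rcons (y ++ t) s), r, r'; rewrite eu ev -!rcons_cat -!catA !rcons_cat.
Qed.

(** Only the two ends must lie in the support; the words of a chain between them may leave it. *)
Definition equivalent_in phi u v := [/\ supp phi u, supp phi v & equivalent u v].

Lemma equivalent_in_refl phi u : supp phi u -> equivalent_in phi u u.
Proof. by move=> su; split=> //; exact: rst_refl. Qed.

Lemma equivalent_in_sym phi u v : equivalent_in phi u v -> equivalent_in phi v u.
Proof. by move=> [su sv uv]; split=> //; exact: rst_sym. Qed.

Lemma equivalent_in_trans phi v u w :
  equivalent_in phi u v -> equivalent_in phi v w -> equivalent_in phi u w.
Proof. by move=> [su _ uv] [_ sw vw]; split=> //; exact: rst_trans vw. Qed.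

Lemma equivalent_in_val phi u v : models _ phi -> equivalent_in phi u v -> phi u = phi v.
Proof. by move=> [_ m] [su sv uv]; exact: m. Qed.

Hypothesis lp : locally_presented Gam.

Lemma equivalent_in_chain phi u v : models _ phi -> equivalent_in phi u v ->
  clos_refl_sym_trans word (supp_similar phi) u v.
Proof.
move=> [cphi mphi] [su sv uv]; apply: lp => // u' v' [su' sv' uv'].
by apply: mphi => //; exact: rst_step.
Qed.

(** Appending [t] is controlled only for similarities inside the support, so the chain given by
    local presentation is extended link by link. *)
Lemma equivalent_in_catr phi u v t : models _ phi -> equivalent_in phi u v ->
  supp phi (u ++ t) -> equivalent_in phi (u ++ t) (v ++ t).
Proof.
move=> mphi /(equivalent_in_chain mphi) uv.
suff : (supp phi (u ++ t) <-> supp phi (v ++ t)) /\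
    (supp phi (u ++ t) -> equivalent (u ++ t) (v ++ t)).
  by move=> [h1 h2] h; split; [|exact/h1|exact: h2].
elim: uv => {u v} [u v uv|u|u v _ [h1 h2]|u v w _ [h1 h2] _ [h3 h4]].
- split; first by split=> h; have [] := cat_similar mphi uv (t := t); tauto.
  by move=> h; have [_ _ ?] := cat_similar mphi uv (or_introl h); exact: rst_step.
- by split=> // _; exact: rst_refl.
- by split; [tauto|move=> h; exact/equivalent_sym/h2/h1].
- by split; [tauto|move=> h; apply: equivalent_trans (h2 h) (h4 (h1.1 h))].
Qed.

(** A chain from [u] to [u'] may become inconsistent behind [v]. Local presentation, applied to the
    consistent map [ashift phi v], replaces it by one whose words all stay in the support behind
    [v]. That [ashift phi v] is a model then follows. *)
Lemma equivalent_in_catl phi v u u' : models _ phi ->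
  equivalent_in (ashift phi v) u u' -> equivalent_in phi (v ++ u) (v ++ u').
Proof.
move=> [cphi mphi] [su su' uu']; split=> //.
have simv a b : supp_similar (ashift phi v) a b -> equivalent (v ++ a) (v ++ b).
  move=> [sa sb [_ _ [x [y [r [r' [rr ea eb]]]]]]]; apply: rst_step.
  split; [exact: (@supp_consistent phi _ cphi sa)
         |exact: (@supp_consistent phi _ cphi sb)|].
  by exists (v ++ x), y, r, r'; rewrite ea eb !catA.
have : clos_refl_sym_trans word (supp_similar (ashift phi v)) u u'.
  apply: lp => //; first by apply: ashift_consistent => //; exact: supp_prefix su.
  by move=> a b ab; apply: mphi; [case: ab|case: ab|exact: simv].
elim=> {u u' su su' uu'} [|u|u u' _|u u' u'' _ h1 _ h2] //; first exact: rst_refl.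
- exact: rst_sym.
- exact: rst_trans h2.
Qed.

Lemma ashift_models phi v : models _ phi -> supp phi v -> models _ (ashift phi v).
Proof.
move=> mphi sv; split; first by apply: ashift_consistent => //; case: mphi.
by move=> a b sa sb ab; apply: (equivalent_in_val mphi); exact: equivalent_in_catl.
Qed.

Lemma ashift_equivalent phi u v : models _ phi -> equivalent_in phi u v ->
  ashift phi u = ashift phi v.
Proof.
move=> mphi uv; apply/funext => t; rewrite /ashift.
have [h|h] := pselect (supp phi (u ++ t)).
  by apply: equivalent_in_val => //; exact: equivalent_in_catr.
have h' : ~ supp phi (v ++ t).
  by move=> h'; have [] := equivalent_in_catr mphi (equivalent_in_sym uv) h'.
by move: h h'; rewrite /supp /=; case: (phi _) => [?[]//|]; case: (phi _) => [? _ []|].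
Qed.

Definition reach phi n u v := exists t, (size t <= n)%N /\ equivalent_in phi (u ++ t) v.

Definition word_connected phi := forall u v, supp phi u -> supp phi v ->
  exists n, reach phi n u v.

Hypothesis sc : forall phi, models _ phi -> word_connected phi.

(* A model graph behaves like the Cayley graph of a groupoid: a return path [z]
   from the end of [v] to its origin is a two-sided inverse of [v]. *)
Lemma equivalent_in_cancel phi v u u' : models _ phi ->
  equivalent_in phi (v ++ u) (v ++ u') -> equivalent_in (ashift phi v) u u'.
Proof.
move=> mphi e; have [svu svu' _] := e.
have sv : supp phi v by exact: supp_prefix mphi.1 svu.
have s0 : supp phi [::] by case: mphi => -[].
have mv := ashift_models mphi sv.
have sv0 : supp (ashift phi v) [::] by case: mv => -[].
have [_ [z [_ vz]]] := sc mphi sv s0.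
have svz : supp (ashift phi v) z by case: vz.
have Evz : ashift phi (v ++ z) = phi by rewrite (ashift_equivalent mphi vz).
have Evz' t : phi (v ++ z ++ t) = phi t by rewrite catA -[in RHS]Evz.
(* A return path [z'] of [z] is equivalent to [v], since both are equivalent to [v ++ z ++ z'];
   hence [z ++ v] closes up. *)
have [_ [z' [_ zz']]] := sc mv svz sv0.
have z'v : equivalent_in phi z' v.
  apply: (@equivalent_in_trans _ (v ++ z ++ z')); last first.
    by have := equivalent_in_catl mphi zz'; rewrite cats0.
  apply: equivalent_in_sym; rewrite catA.
  apply: (equivalent_in_catr (v := [::])) => //.
  by rewrite -catA; case: zz'.
have zv : equivalent_in (ashift phi v) (z ++ v) [::].
  apply: equivalent_in_trans zz'.
  apply: equivalent_in_catl => //; apply: equivalent_in_sym.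
  by rewrite (_ : ashift _ z = phi) //; apply/funext => t; exact: Evz'.
have zvt t : supp phi (v ++ t) -> equivalent_in (ashift phi v) (z ++ v ++ t) t.
  move=> h; rewrite catA -[X in equivalent_in _ _ X]cat0s.
  apply: equivalent_in_catr => //.
  by rewrite /supp /= /ashift -catA Evz'.
apply: equivalent_in_trans (zvt _ svu').
apply: equivalent_in_trans (equivalent_in_sym (zvt _ svu)) _.
apply: equivalent_in_catl => //.
by rewrite (_ : ashift _ z = phi) //; apply/funext => t; exact: Evz'.
Qed.
End Words.

(** * Word form of quasi-isometries *)

Section Distance.
Variables (L : Type) (G : lgraph L).
Hypothesis sc : strongly_connected_graph G.

Lemma walk_cat m n (x y z : vertex G) : walk m x y -> walk n y z -> walk (m + n) x z.
Proof.
move=> [p [sp pp lp]] [q [sq pq lq]]; exists (p ++ q).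
by rewrite size_cat sp sq cat_path pp lp pq last_cat lp lq.
Qed.

Lemma dist_spec (x y : vertex G) :
  walk (dist x y) x y /\ forall m, walk m x y -> (dist x y <= m)%N.
Proof.
apply: (@xgetPex _ _ [set n | walk n x y /\ forall m, walk m x y -> (n <= m)%N]).
have [n hn] := sc x y.
have ex : exists n, `[< walk n x y >] by exists n; apply/asboolP.
exists (ex_minn ex); case: ex_minnP => m /asboolP wm min; split=> // k wk.
by apply: min; apply/asboolP.
Qed.

Lemma dist_triangle (y x z : vertex G) : (dist x z <= dist x y + dist y z)%N.
Proof. by apply: (dist_spec x z).2; apply: walk_cat; exact: (dist_spec _ _).1. Qed.

End Distance.

(** * Distances in a model graph in terms of words *)

Section ModelGraph.
Variables (Gam : blueprint) (phi : seq (gen Gam) -> option (state Gam)).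
Hypotheses (lp : locally_presented Gam) (mphi : models Gam phi).
Local Notation V := (vertex (model_graph phi)).
Implicit Types (x y : V) (a b t : seq (gen Gam)).

Definition vertex_of a (sa : supp phi a) : V :=
  exist _ (wclass a) (mem_set (ex_intro2 _ _ a sa erefl)).

Definition repr x : seq (gen Gam) := some_in [::] [set a | supp phi a /\ \val x = wclass a].

Lemma reprP x : supp phi (repr x) /\ \val x = wclass (repr x).
Proof.
apply: (@some_inP _ _ [set a | supp phi a /\ \val x = wclass a]).
by have [a sa ea] := set_mem (valP x); exists a.
Qed.

Lemma eq_repr x y : equivalent (repr x) (repr y) -> x = y.
Proof.
by move=> /wclass_eq e; apply: val_inj; rewrite (reprP x).2 (reprP y).2.
Qed.

Lemma repr_vertex_of a (sa : supp phi a) : equivalent_in phi (repr (vertex_of sa)) a.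
Proof.
by have [h1 h2] := reprP (vertex_of sa); split=> //; apply/wclass_eq; rewrite -h2.
Qed.

(** An edge is witnessed by some representative of its source; right congruence moves it to the word
    read so far. *)
Lemma walk_reach n x y a : supp phi a -> \val x = wclass a -> walk n x y ->
  exists t, [/\ size t = n, supp phi (a ++ t) & \val y = wclass (a ++ t)].
Proof.
move=> sa xa [p [<- {n}]]; elim: p x a sa xa => [|z p IH] x a sa xa /=.
  by move=> _ <-; exists [::]; rewrite cats0.
move=> /andP[/asboolP[s [w [sw pw xw zw]]]] pp lpy.
have wa : equivalent_in phi w a by split=> //; apply/wclass_eq; rewrite -xw.
have sws : supp phi (w ++ [:: s]) by rewrite cats1; apply/supp_rconsP => //; case: mphi.
have [_ sas e] := equivalent_in_catr lp mphi wa sws.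
have zas : \val z = wclass (a ++ [:: s])
  by apply: (etrans zw); rewrite -cats1; apply/wclass_eq.
have [t [st sat yt]] := IH _ _ sas zas pp lpy.
by exists (s :: t); rewrite /= st -cat1s catA.
Qed.

Lemma reach_walk t x y a : supp phi (a ++ t) -> \val x = wclass a ->
  \val y = wclass (a ++ t) -> walk (size t) x y.
Proof.
elim: t x a => [|s t IH] x a.
  by rewrite cats0 => _ xa ya; exists [::]; split=> //=; apply: val_inj; rewrite xa ya.
rewrite -cat1s catA => sat xa ya; rewrite size_cat.
have sas : supp phi (a ++ [:: s]) by exact: supp_prefix mphi.1 sat.
apply: (@walk_cat _ _ _ _ _ (vertex_of sas)); last exact: (IH _ _ sat).
exists [:: vertex_of sas]; split=> //=; rewrite andbT; apply/asboolP.
exists s, a; rewrite -cats1; split=> //; first exact: supp_prefix mphi.1 sas.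
by apply/supp_rconsP; [exact: mphi.1|rewrite -cats1].
Qed.

Lemma walk_reprP n x y : walk n x y <->
  exists t, size t = n /\ equivalent_in phi (repr x ++ t) (repr y).
Proof.
have [sx xx] := reprP x; have [sy yy] := reprP y; split.
  move=> /(walk_reach sx xx)[t [st sxt yt]]; exists t; split=> //; split=> //.
  by apply/wclass_eq; rewrite -yt.
move=> [t [<- [sxt _ e]]]; apply: (reach_walk sxt) => //.
by rewrite yy; apply/esym/wclass_eq.
Qed.

Hypothesis sc : strongly_connected_graph (model_graph phi).

Lemma dist_reach n x y : (dist x y <= n)%N <-> reach phi n (repr x) (repr y).
Proof.
split=> [h|[t [st e]]].
  have /walk_reprP[t [st e]] := (dist_spec sc x y).1.
  by exists t; rewrite st.
apply: leq_trans st; apply: (dist_spec sc x y).2; apply/walk_reprP.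
by exists t.
Qed.

Lemma reach_equivalent n u u' v v' : equivalent_in phi u u' -> equivalent_in phi v v' ->
  reach phi n u v -> reach phi n u' v'.
Proof.
move=> uu' vv' [t [st e]]; exists t; split=> //.
apply: equivalent_in_trans vv'; apply: (equivalent_in_trans _ e).
by apply: equivalent_in_sym; apply: equivalent_in_catr => //; case: e.
Qed.

Lemma strongly_connected_words : word_connected phi.
Proof.
move=> u v su sv; exists (dist (vertex_of su) (vertex_of sv)).
by apply: reach_equivalent (repr_vertex_of _) (repr_vertex_of _) _; exact/dist_reach.
Qed.

End ModelGraph.

(** One natural constant serves for all bounds, and the lower bound is multiplied out to avoid
    division. *)
Definition nat_qi (L L' : Type) (G : lgraph L) (G' : lgraph L') N
    (f : vertex G -> vertex G') :=
  [/\ forall x y, (dist (f x) (f y) <= N * dist x y + N)%N,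
      forall x y, (dist x y <= N * (dist (f x) (f y) + N))%N
    & forall z, exists x, (dist z (f x) <= N)%N /\ (dist (f x) z <= N)%N].

Lemma quasi_isometric_nat (R : realType) (Gam1 Gam2 : blueprint) phi1 phi2 :
  quasi_isometric (@rho Gam1 R phi1) (@rho Gam2 R phi2) ->
  exists N f, @nat_qi _ _ (model_graph phi1) (model_graph phi2) N f.
Proof.
move=> [f [C [D [lam [C0 D0 lam1 h1 h2]]]]].
have [N [NC ND Nl]] : exists N : nat, [/\ C <= N%:R, D <= N%:R & lam <= N%:R]%R.
  have l0 : (0 <= lam)%R by apply: le_trans lam1.
  exists (Num.bound C + Num.bound D + Num.bound lam)%N; rewrite !natrD.
  have := archi_boundP C0; have := archi_boundP D0; have := archi_boundP l0.
  by split; lra.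
have N1 : (1 <= N%:R :> R)%R by lra.
exists N, f; split=> [x y|x y|z].
- have /andP[_] := h1 x y; rewrite /rho => h; rewrite -(ler_nat R) natrD natrM.
  apply: le_trans h _; apply: lerD => //; exact: ler_wpM2r.
- have /andP[h _] := h1 x y; rewrite /rho in h; rewrite -(ler_nat R) natrM natrD.
  rewrite lerBlDr ler_pdivrMl in h; last lra.
  by apply: le_trans h _; apply: ler_pM => //; [lra|exact: addr_ge0|exact: lerD].
- have [x] := h2 z; rewrite ge_max /rho => /andP[a b]; exists x.
  by rewrite -!(ler_nat R); split; [apply: le_trans a _|apply: le_trans b _].
Qed.

Lemma nat_qi_inverse (L L' : Type) (G : lgraph L) (G' : lgraph L') N f :
  strongly_connected_graph G' ->
  @nat_qi _ _ G G' N f -> exists N' h, @nat_qi _ _ G' G N' h.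
Proof.
move=> sc [h1 h2 h3]; have [h hP] := choice h3.
(* As [f (h z)] lies within [N] of [z] in both directions, triangle inequalities bound the distance
   of images under [h] by [N * r + 3 * N * N], where [r] is the original distance, and [r] by
   [N * k + 3 * N], where [k] is the distance of the images. The density bound is [2 * N * N]. *)
exists (3 * N * N + 3 * N)%N, h; split=> [z z'|z z'|x].
- have := h2 (h z) (h z'); have [a b] := hP z; have [c d] := hP z'.
  have := dist_triangle sc z (f (h z)) (f (h z')).
  have := dist_triangle sc z' z (f (h z')).
  nia.
- have := h1 (h z) (h z'); have [a b] := hP z; have [c d] := hP z'.
  have := dist_triangle sc (f (h z)) z z'.
  have := dist_triangle sc (f (h z')) (f (h z)) z'.
  set u := dist (f (h z)) (f (h z')); set k := dist (h z) (h z').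
  set r := dist z z' => t1 t2 t3.
  have t4 : (r <= N * k + 3 * N)%N by lia.
  apply: leq_trans t4 _; nia.
- exists (f x); have [a b] := hP (f x).
  by split; [have := h2 x (h (f x))|have := h2 (h (f x)) x]; nia.
Qed.

(** * Subshifts defined by local rules *)

Section LocalRules.
Variables (Gam : blueprint) (B : finType).
Hypotheses (finM : finite_set [set: state Gam]) (finS : finite_set [set: gen Gam]).
Local Notation word := (seq (gen Gam)).
Implicit Types (c : config Gam B) (u w : word).

Definition valid c := consistent_map c.1 /\ supp c.2 = supp c.1.

Definition agree n c c' := forall u, (size u <= n)%N -> c.1 u = c'.1 u /\ c.2 u = c'.2 u.

Lemma agree_sym n c c' : agree n c c' -> agree n c' c.
Proof. by move=> h u /h[-> ->]. Qed.

Definition local n (Q : config Gam B -> Prop) := forall c c', agree n c c' -> Q c -> Q c'.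

Definition restr n c : word -> option (state Gam * B) := fun u =>
  if (size u <= n)%N then
    if c.1 u is Some m then omap (pair m) (c.2 u) else None
  else None.

Lemma supp_None T (f : word -> option T) u : ~ supp f u -> f u = None.
Proof. by rewrite /supp /=; case: (f u) => // ? []. Qed.

Lemma restr_Some n c u m b : restr n c u = Some (m, b) ->
  [/\ (size u <= n)%N, c.1 u = Some m & c.2 u = Some b].
Proof.
rewrite /restr; case: leqP => //; case: (c.1 u) => // m'.
by case: (c.2 u) => //= b' _ [-> ->].
Qed.

Lemma restr_supp n c u : valid c -> (size u <= n)%N -> supp c.1 u ->
  exists m b, [/\ restr n c u = Some (m, b), c.1 u = Some m & c.2 u = Some b].
Proof.
move=> [_ e] h su; have : supp c.2 u by rewrite e.
move: su; rewrite /restr h /supp /=; case: (c.1 u) => // m _; case: (c.2 u) => // b _.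
by exists m, b.
Qed.

(** The pattern imposes nothing outside the support of [c], but there consistency decides: a word
    leaves the support when its next generator does not fit the current state, and the states inside
    are shared. *)
Lemma match_agree n c c' : valid c -> valid c' ->
  (forall u m b, restr n c u = Some (m, b) -> c'.1 u = Some m /\ c'.2 u = Some b) ->
  agree n c c'.
Proof.
move=> vc vc' h.
have out u : (size u <= n)%N -> ~ supp c.1 u -> ~ supp c'.1 u.
  elim/last_ind: u => [|u s IH]; first by case: vc => -[].
  rewrite size_rcons => su; rewrite (supp_rconsP _ _ vc.1) (supp_rconsP _ _ vc'.1).
  have su' := ltnW su; move=> h1 h2; have [hu|hu] := pselect (supp c.1 u).
    have [m [b [r e _]]] := restr_supp vc su' hu.
    by have [e' _] := h _ _ _ r; case: h1; rewrite e -e'.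
  by apply: (IH su' hu); rewrite /supp /= h2.
move=> u su; have [hu|hu] := pselect (supp c.1 u).
  by have [m [b [r -> ->]]] := restr_supp vc su hu; have [-> ->] := h _ _ _ r.
have hu' := out u su hu.
rewrite (supp_None hu) (supp_None hu').
by rewrite (@supp_None _ c.2 u) ?vc.2// (@supp_None _ c'.2 u) ?vc'.2.
Qed.

Lemma shift_valid c w : valid c -> supp c.1 w -> valid (shift c w).
Proof.
move=> [cc e] sw; split; first exact: ashift_consistent.
exact: (congr1 (fun A => [set u | A (w ++ u)]) e).
Qed.

Definition local_subshift (Q : config Gam B -> Prop) : set (config Gam B) :=
  [set c | models Gam c.1 /\ [/\ supp c.2 = supp c.1,
    forall u v, supp c.1 u -> supp c.1 v -> equivalent u v -> c.2 u = c.2 v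
  & forall w, supp c.1 w -> Q (shift c w)]].

Lemma ball_finite n : finite_set [set u : word | (size u <= n)%N].
Proof.
apply: (@sub_finite_set _ _ [set bseqval b | b in [set: n.-bseq (fin_of finS)]]).
  by move=> u su; exists (Bseq su).
by apply: finite_image; exact: finite_finset.
Qed.

Lemma ball_functions_finite n (T : finType) :
  finite_set [set p : word -> option T | forall u, p u <> None -> (size u <= n)%N].
Proof.
pose W := n.-bseq (fin_of finS).
pose ext (h : {ffun W -> option T}) : word -> option T :=
  fun u => if insub u is Some b then h b else None.
apply: (@sub_finite_set _ _ [set ext h | h in [set: {ffun W -> option T}]]); last first.
  by apply: finite_image; exact: finite_finset.
move=> p hp; exists [ffun b : W => p b] => //; apply/funext => u; rewrite /ext.
case: insubP => [b _ <-|h]; first by rewrite ffunE.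
by case: (pselect (p u = None)) => [->//|/hp]; rewrite (negbTE h).
Qed.

(** The forbidden patterns are the [n]-balls of valid configurations that violate [Q], finitely many
    since ball and alphabet are finite. By [match_agree] an occurrence forces agreement on the whole
    ball, hence a violation of [Q]. *)
Lemma local_subshift_SFT n Q : local n Q -> is_SFT (local_subshift Q).
Proof.
move=> locQ; exists [set p | exists c, [/\ valid c, ~ Q c & p = restr n c]]; split.
- move=> p [c [vc nQ ->]]; apply: (@sub_finite_set _ _ _ _ (ball_finite n)).
  by move=> u; rewrite /supp /= /restr; case: leqP.
- apply: (@sub_finite_set _ _ _ _ (@ball_functions_finite n (fin_of finM * B)%type)).
  by move=> p [c [vc nQ ->]] u; rewrite /restr; case: leqP.
apply/seteqP; split=> c [mc [e inv h]]; split=> //; split=> //.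
- move=> p w [c' [vc' nQ ->]] sw; apply: contrapT => no.
  apply: nQ; apply: locQ (h w sw); apply: agree_sym; apply: match_agree => //.
    by apply: shift_valid => //; split=> //; exact: mc.1.
  move=> u m b r; apply: contrapT => ne; apply: no; exists u, m, b; split=> //.
  by move=> [e1 e2]; exact: ne.
- move=> w sw; apply: contrapT => nQ.
  have vs : valid (shift c w) by apply: shift_valid => //; split=> //; exact: mc.1.
  have [|u [m [b [/restr_Some[_ e1 e2] []]]]] := h (restr n (shift c w)) w _ sw.
    by exists (shift c w).
  by move: e1 e2 => /= -> ->.
Qed.
End LocalRules.

(** * Encoding configurations over another blueprint *)

Section Encoding.
Variables (G H : blueprint) (A : finType).
Hypotheses (finMG : finite_set [set: state G]) (finSG : finite_set [set: gen G]).
Hypothesis finSH : finite_set [set: gen H].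
Variables K L : nat.

(* Labels the points of one fibre: the label of a point is a word that leads to it
   from a chosen base point of the fibre. *)
Definition index : finType := L.-bseq (fin_of finSG).
Definition pointer : finType := (K.-bseq (fin_of finSH) * index)%type.
Definition marking : finType := (fin_of finMG * A * {ffun fin_of finSG -> pointer})%type.
Definition cell : finType := {ffun index -> option marking}.

Definition place : Type := (seq (gen H) * index)%type.
Implicit Types (y : seq (gen H) -> option cell) (p q : place) (a b : seq (gen G)).

Definition marking_state (e : marking) : state G := e.1.1.
Definition marking_letter (e : marking) : A := e.1.2.
Definition offset (e : marking) (s : gen G) : seq (gen H) := (e.2 s).1.
Definition target (e : marking) (s : gen G) : index := (e.2 s).2.

Lemma size_offset e s : (size (offset e s) <= K)%N.
Proof. exact: size_bseq. Qed.

Definition entry y p : option marking := if y p.1 is Some b then b p.2 else None.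

Definition step y p s : option place :=
  if entry y p is Some e then
    if `[< marking_state e = ini s >]
    then Some (p.1 ++ offset e s, target e s) else None
  else None.

Fixpoint trace y p a : option place :=
  if a is s :: a' then obind (fun q => trace y q a') (step y p s) else Some p.

(** The value is [None] when the trace breaks off, in line with a configuration of [G] outside its
    support. *)
Definition decode_state y p a : option (state G) :=
  obind (fun q => omap marking_state (entry y q)) (trace y p a).
Definition decode_letter y p a : option A :=
  obind (fun q => omap marking_letter (entry y q)) (trace y p a).

Definition translate (w : seq (gen H)) p : place := (w ++ p.1, p.2).

Definition same (phi : seq (gen H) -> option (state H)) p q :=
  equivalent_in phi p.1 q.1 /\ p.2 = q.2.

Lemma trace_cat y p a b : trace y p (a ++ b) = obind (fun q => trace y q b) (trace y p a).
Proof. by elim: a p => //= s a IH p; case: step. Qed.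

Lemma trace_rcons y p a s : trace y p (rcons a s) = obind (fun q => step y q s) (trace y p a).
Proof. by rewrite -cats1 trace_cat /=; case: trace => //= q; case: step. Qed.

Lemma step_translate y w p s :
  step y (translate w p) s = omap (translate w) (step (fun u => y (w ++ u)) p s).
Proof.
rewrite /step /entry /=; case: (y _) => // c; case: (c _) => // e.
by case: asboolP => //= _; rewrite /translate /= catA.
Qed.

Lemma trace_translate y w p a :
  trace y (translate w p) a = omap (translate w) (trace (fun u => y (w ++ u)) p a).
Proof. by elim: a p => //= s a IH p; rewrite step_translate; case: step => //= q. Qed.

Lemma decode_translate y w p :
  decode_state y (translate w p) = decode_state (fun u => y (w ++ u)) p /\
  decode_letter y (translate w p) = decode_letter (fun u => y (w ++ u)) p.
Proof.
split; apply/funext => a; rewrite /decode_state /decode_letter trace_translate;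
  by case: trace.
Qed.

Lemma decode_cat y p q a : trace y p a = Some q ->
  (forall b, decode_state y p (a ++ b) = decode_state y q b) /\
  (forall b, decode_letter y p (a ++ b) = decode_letter y q b).
Proof. by move=> e; split=> b; rewrite /decode_state /decode_letter trace_cat e. Qed.

Variables (D L0 : nat) (F : set (seq (gen G) -> option (state G * A))).

(* For a vertex [v] and a place [p] over it, the clauses ask that
   - a marked place lies at distance at most [D] from [v], in both directions;
   - the successors of [p] are marked, with an admissible state;
   - the relations of [G] hold at [p];
   - no pattern of [F] occurs at [p];
   - marked places near [p] are reachable from [p] by decoded words. *)
Definition rules (c : config H cell) : Prop :=
  (exists u u' i, [/\ (size u <= D)%N, (size u' <= D)%N, entry c.2 (u, i) <> None
     & equivalent_in c.1 (u ++ u') [::]]) /\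
  forall i e, entry c.2 ([::], i) = Some e ->
  [/\ forall s, marking_state e = ini s -> exists q e',
        [/\ step c.2 ([::], i) s = Some q, entry c.2 q = Some e'
          & ter s (marking_state e')],
      forall r r' q q', rels G (r, r') -> trace c.2 ([::], i) r = Some q ->
        trace c.2 ([::], i) r' = Some q' -> same c.1 q q',
      forall f, F f -> exists u m x, f u = Some (m, x) /\
        (decode_state c.2 ([::], i) u, decode_letter c.2 ([::], i) u) <> (Some m, Some x)
    & forall u j, (size u <= L0)%N -> entry c.2 (u, j) <> None -> supp c.1 u ->
        exists a q, [/\ (size a <= L)%N, trace c.2 ([::], i) a = Some q
          & same c.1 q (u, j)]].

Section Locality.
Variables (n : nat) (c c' : config H cell).
Hypothesis cc' : agree n c c'.

Lemma entry_agree p : (size p.1 <= n)%N -> entry c.2 p = entry c'.2 p.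
Proof. by move=> /cc'[_ e]; rewrite /entry e. Qed.

Lemma trace_size y p a q : trace y p a = Some q -> (size q.1 <= size p.1 + K * size a)%N.
Proof.
elim: a p => [|s a IH] p /=; first by move=> [->]; lia.
rewrite /step; case: entry => // e; case: asboolP => // _ /= /IH /=.
by rewrite size_cat; have := size_offset e s; lia.
Qed.

Lemma step_agree p s : (size p.1 <= n)%N -> step c.2 p s = step c'.2 p s.
Proof. by move=> h; rewrite /step entry_agree. Qed.

Lemma trace_agree p a : (size p.1 + K * size a <= n)%N -> trace c.2 p a = trace c'.2 p a.
Proof.
elim/last_ind: a => [|a s IH]//; rewrite size_rcons => h.
rewrite !trace_rcons -IH; last lia.
case e: trace => [q|] //=; apply: step_agree; have := trace_size e; lia.
Qed.

Lemma decode_agree p a : (size p.1 + K * size a <= n)%N ->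
  decode_state c.2 p a = decode_state c'.2 p a /\
  decode_letter c.2 p a = decode_letter c'.2 p a.
Proof.
move=> h; rewrite /decode_state /decode_letter -trace_agree//; case e: trace => [q|] //=.
by rewrite entry_agree//; have := trace_size e; lia.
Qed.

Lemma supp_agree u : (size u <= n)%N -> supp c.1 u -> supp c'.1 u.
Proof. by move=> /cc'[e _]; rewrite /supp /= e. Qed.

Lemma equivalent_in_agree u v : (size u <= n)%N -> (size v <= n)%N ->
  equivalent_in c.1 u v -> equivalent_in c'.1 u v.
Proof. by move=> hu hv [su sv e]; split=> //; apply: supp_agree. Qed.

End Locality.

(** A trace of length at most [N] moves by at most [K * N]. The other summands leave room for a
    single step, for a place at distance [L0] and for the loop [u ++ u'] of length at most
    [2 * D]. *)
Lemma rules_local N :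
  (forall r r', rels G (r, r') -> (size r <= N)%N /\ (size r' <= N)%N) ->
  (forall f u, F f -> supp f u -> (size u <= N)%N) -> (L <= N)%N ->
  local (K * N + K + L0 + 2 * D) rules.
Proof.
move=> hR hF hL c c' ag [[u [u' [i [hu hu' eu e]]]] h]; split.
  exists u, u', i; split=> //; first by rewrite -(entry_agree ag)//=; lia.
  by apply: (equivalent_in_agree ag) e => //=; rewrite size_cat; lia.
have ag' := agree_sym ag.
move=> {u u' hu hu' eu e} {}i e; rewrite -(entry_agree ag)//= => /h[h1 h2 h3 h4]; split.
- move=> s /h1[q [e' [hs hq ht]]]; exists q, e'.
  rewrite -(step_agree ag)// -(entry_agree ag)//.
  have : trace c.2 ([::], i) [:: s] = Some q by rewrite /= hs.
  by move=> /trace_size /=; lia.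
- move=> r r' q q' rr; have [sr sr'] := hR _ _ rr.
  have kr : (K * size r <= K * N)%N by rewrite leq_mul2l sr orbT.
  have kr' : (K * size r' <= K * N)%N by rewrite leq_mul2l sr' orbT.
  rewrite -!(trace_agree ag) /=; [|lia|lia] => t t'; have [e1 e2] := h2 _ _ _ _ rr t t'.
  split=> //; apply: (equivalent_in_agree ag) e1.
    by apply: leq_trans (trace_size t) _ => /=; lia.
  by apply: leq_trans (trace_size t') _ => /=; lia.
- move=> p /[dup] Fp /h3[u [m [a [pu ne]]]]; exists u, m, a; split=> //.
  have su : (size u <= N)%N by apply: hF Fp _; rewrite /supp /= pu.
  have ku : (K * size u <= K * N)%N by rewrite leq_mul2l su orbT.
  have [<- <-] : decode_state c.2 ([::], i) u = decode_state c'.2 ([::], i) u /\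
    decode_letter c.2 ([::], i) u = decode_letter c'.2 ([::], i) u
    by apply: decode_agree ag _ _ _ => /=; lia.
  by [].
- move=> u j su; rewrite -(entry_agree ag)/=; last lia; move=> eu sc.
  have {}sc : supp c.1 u by apply: (supp_agree ag') sc; lia.
  have [a [q [sa t [e1 e2]]]] := h4 _ _ su eu sc; exists a, q.
  have ka : (K * size a <= K * N)%N by rewrite leq_mul2l (leq_trans sa hL) orbT.
  rewrite -(trace_agree ag)/=; last lia; split=> //; split=> //.
  apply: (equivalent_in_agree ag) e1; last by move=> /=; lia.
  by apply: leq_trans (trace_size t) _ => /=; lia.
Qed.

End Encoding.

(** * Decoding *)

Section Decoding.
Variables (G H : blueprint) (A : finType).
Hypotheses (finMG : finite_set [set: state G]) (finSG : finite_set [set: gen G]).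
Hypothesis finSH : finite_set [set: gen H].
Hypotheses (lpG : locally_presented G) (lpH : locally_presented H).
Variables (K L D L0 : nat) (F : set (seq (gen G) -> option (state G * A))).
Hypothesis D_L0 : (2 * D + 1 <= L0)%N.
Local Notation cell := (cell A finMG finSG finSH K L).
Local Notation place := (place H finSG L).
Local Notation rules := (@rules G H A finMG finSG finSH K L D L0 F).
Variable c : config H cell.
Hypothesis cQ : local_subshift rules c.
Local Notation phi := c.1.
Local Notation y := c.2.
Implicit Types (p q : place) (a b : seq (gen G)) (v w : seq (gen H)).

Let mphi : models H phi. Proof. by case: cQ. Qed.
Let suppy : supp y = supp phi. Proof. by case: cQ => _ []. Qed.
Let inv v w : equivalent_in phi v w -> y v = y w.
Proof. by case: cQ => _ [_ h _] [? ? ?]; exact: h. Qed.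

Lemma entry_supp p : entry y p <> None -> supp phi p.1.
Proof. by rewrite -suppy /entry /supp /=; case: (y _). Qed.

Lemma entry_same p q : same phi p q -> entry y p = entry y q.
Proof. by move=> [/inv e1 e2]; rewrite /entry e1 e2. Qed.

Lemma same_sym p q : same phi p q -> same phi q p.
Proof. by move=> [/equivalent_in_sym e1 e2]. Qed.

Lemma same_trans q p r : same phi p q -> same phi q r -> same phi p r.
Proof. by move=> [e1 e2] [e3 e4]; split; [exact: equivalent_in_trans e3|rewrite e2]. Qed.

Lemma same_translate v p q : same (ashift phi v) p q -> same phi (translate v p) (translate v q).
Proof. by move=> [e1 e2]; split=> //; exact: (equivalent_in_catl lpH mphi). Qed.

(** The rules are imposed at the origin of every shift; translation carries them to an arbitrary
    marked place. *)
Lemma rules_at p e : entry y p = Some e ->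
  [/\ forall s, marking_state e = ini s -> exists q e',
        [/\ step y p s = Some q, entry y q = Some e' & ter s (marking_state e')],
      forall r r' q q', rels G (r, r') -> trace y p r = Some q ->
        trace y p r' = Some q' -> same phi q q',
      forall f, F f -> exists u m x, f u = Some (m, x) /\
        (decode_state y p u, decode_letter y p u) <> (Some m, Some x)
    & forall u j, (size u <= L0)%N -> entry y (p.1 ++ u, j) <> None ->
        exists a q, trace y p a = Some q /\ same phi q (p.1 ++ u, j)].
Proof.
move=> hp; have sp : supp phi p.1 by apply: entry_supp; rewrite hp.
have [_ [_ _ /(_ _ sp)[_ R]]] := cQ.
have ep : p = translate p.1 ([::], p.2) by case: (p) => v i; rewrite /translate /= cats0.
have hp' : entry (shift c p.1).2 ([::], p.2) = Some e by move: hp; rewrite {1}ep.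
have {R} [R1 R2 R3 R4] := R _ _ hp'; split.
- move=> s /R1[q [e' [hq he' ht]]]; exists (translate p.1 q), e'.
  split; [|exact: he'|exact: ht].
  by rewrite {1}ep step_translate; exact: (congr1 (omap (translate p.1)) hq).
- move=> r r' q q' rr; rewrite {1 2}ep !trace_translate.
  case t: trace => [q1|] //= -[<-]; case t': trace => [q2|] //= -[<-].
  by apply: same_translate; exact: R2 rr t t'.
- move=> f /R3[u [m [x [fu ne]]]]; exists u, m, x; split=> //.
  by rewrite ep; have [-> ->] := decode_translate y p.1 ([::], p.2).
- move=> u j su eu.
  have [a [q [sa t e1]]] := R4 u j su eu (entry_supp eu).
  exists a, (translate p.1 q); split; last exact: same_translate e1.
  by rewrite {1}ep trace_translate; exact: (congr1 (omap (translate p.1)) t).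
Qed.

Lemma step_entry p s q : step y p s = Some q -> entry y q <> None.
Proof.
rewrite {1}/step; case hp : entry => [e|] //; case: asboolP => // es [eq].
have [/(_ _ es)[q' [e' [hs he' _]]] _ _ _] := rules_at hp.
move: hs; rewrite /step hp; case: asboolP => // _ [eq'].
by rewrite -eq eq' he'.
Qed.

Lemma trace_entry p a q : entry y p <> None -> trace y p a = Some q -> entry y q <> None.
Proof.
elim: a p => [|s a IH] p /= hp; first by move=> [<-].
by case hs: step => [q'|] //= /(IH _ (step_entry hs)).
Qed.

Lemma step_same p q s p' : same phi p q -> step y p s = Some p' ->
  exists2 q', step y q s = Some q' & same phi p' q'.
Proof.
move=> pq hs; have sp := entry_supp (step_entry hs).
move: hs; rewrite /step (entry_same pq); case: entry => // e; case: asboolP => // _ [ep'].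
exists (q.1 ++ offset e s, target e s) => //; rewrite -ep' in sp *; split=> //=.
by apply: equivalent_in_catr => //; case: pq.
Qed.

Lemma trace_same p q a p' : same phi p q -> trace y p a = Some p' ->
  exists2 q', trace y q a = Some q' & same phi p' q'.
Proof.
elim: a p q => [|s a IH] p q pq /=; first by move=> [<-]; exists q.
by case hs: step => [p1|] //= h; have [q1 -> /= pq1] := step_same pq hs; exact: IH h.
Qed.

Lemma decode_same p q : same phi p q ->
  decode_state y p = decode_state y q /\ decode_letter y p = decode_letter y q.
Proof.
move=> pq; suff h a : decode_state y p a = decode_state y q a /\
    decode_letter y p a = decode_letter y q a.
  by split; apply/funext => a; have [] := h a.
rewrite /decode_state /decode_letter; case hp: trace => [p'|].
  by have [q' -> /= e] := trace_same pq hp; rewrite (entry_same e).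
case hq: trace => [q'|] //.
by have [p'] := trace_same (same_sym pq) hq; rewrite hp.
Qed.

(** * The configuration read from a marked place *)

Section Base.
Variable p : place.
Hypothesis p_entry : entry y p <> None.
Local Notation psi := (decode_state y p).
Local Notation x := (decode_letter y p).

Lemma supp_traceP a : supp psi a <-> exists q, trace y p a = Some q.
Proof.
rewrite /supp /= /decode_state; split; first by case: trace => // q _; exists q.
move=> [q hq]; rewrite hq /=; have := trace_entry p_entry hq.
by case: entry.
Qed.

Lemma decode_consistent : consistent_map psi.
Proof.
split; first by rewrite /decode_state /=; case: entry p_entry.
move=> a s; rewrite /decode_state trace_rcons; case t: trace => [q|] //=.
rewrite /step; case eq: entry => [e|]; last by split.
have [R1 _ _ _] := rules_at eq; rewrite /=; split=> [[es]|].
  have [q' [e' [hs he' ht]]] := R1 _ es; exists (marking_state e') => //.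
  by move: hs; rewrite /step eq; case: asboolP => //= _ [->]; rewrite he'.
by case: asboolP => // -> [].
Qed.

(** The relation rule applies at the place where the common prefix ends, and following the common
    suffix preserves [same]. *)
Lemma similar_trace a b : supp_similar psi a b ->
  exists q q', [/\ trace y p a = Some q, trace y p b = Some q' & same phi q q'].
Proof.
move=> [/supp_traceP[q hq] /supp_traceP[q' hq'] [_ _ [u [v [r [r' [rr ea eb]]]]]]].
exists q, q'; split=> //; move: hq hq'; rewrite ea eb !trace_cat.
case tu: trace => [p1|] //=; rewrite !trace_cat.
case tr: (trace y p1 r) => [q1|] //=; case tr': (trace y p1 r') => [q1'|] //= tv tv'.
have := trace_entry p_entry tu; case ep1: entry => [e|] // _.
have [_ R2 _ _] := rules_at ep1; have qq1 := R2 _ _ _ _ rr tr tr'.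
by have [q''] := trace_same qq1 tv; rewrite tv' => -[<-].
Qed.

(** Local presentation of [G] asks only for a consistent map with equal values at similar words, so
    it applies to the decoded map before that map is known to be a model. *)
Lemma decode_equivalent a b : equivalent_in psi a b ->
  exists q q', [/\ trace y p a = Some q, trace y p b = Some q' & same phi q q'].
Proof.
have refl a' q : trace y p a' = Some q -> same phi q q.
  by move=> hq; split=> //; apply/equivalent_in_refl/entry_supp/(trace_entry p_entry hq).
move=> [sa sb ab]; have {ab} : clos_refl_sym_trans _ (supp_similar psi) a b.
  apply: lpG => //; first exact: decode_consistent.
  move=> u v /similar_trace[q [q' [tu tv qq']]].
  by rewrite /decode_state tu tv /= (entry_same qq').
(* The first alternative covers reflexive links, which may occur at words without a trace. *)
suff h a' b' : clos_refl_sym_trans _ (supp_similar psi) a' b' ->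
  trace y p a' = trace y p b' \/
  exists q q', [/\ trace y p a' = Some q, trace y p b' = Some q' & same phi q q'].
  move=> /h[e|//]; have /supp_traceP[q hq] := sa; exists q, q; rewrite -e hq; split=> //.
  exact: refl hq.
elim=> {a' b'} [u v /similar_trace|u|u v _ [->|[q [q' [t t' e]]]]|u v w _ h1 _ h2];
  [by right|by left|by left| |].
  by right; exists q', q; split=> //; exact: same_sym.
case: h1 => [->//|[q [q' [t t' e]]]]; right; case: h2 => [<-|[q1 [q1' [t1 t1' e1]]]].
  by exists q, q'.
exists q, q1'; split=> //; apply: same_trans e _.
by move: t1; rewrite t' => -[->].
Qed.

Lemma decode_subshift : subshift F (psi, x).
Proof.
have mpsi : models G psi.
  split; first exact: decode_consistent.
  move=> a b sa sb ab; have [//|q [q' [ta tb qq']]] := @decode_equivalent a b.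
  by rewrite /decode_state ta tb /= (entry_same qq').
split=> //; split=> /=.
- apply/seteqP; split=> a; rewrite /supp /= /decode_state /decode_letter;
  by case: trace => //= q; case: entry.
- move=> a b sa sb ab; have [//|q [q' [ta tb qq']]] := @decode_equivalent a b.
  by rewrite /decode_letter ta tb /= (entry_same qq').
- move=> f w Ff /supp_traceP[q tq].
  have := trace_entry p_entry tq; case eq: entry => [e|] // _.
  have [_ _ R3 _] := rules_at eq; have [u [m [a [fu ne]]]] := R3 _ Ff.
  exists u, m, a; split=> //.
  by have [-> ->] := decode_cat tq.
Qed.

(** Every vertex along the path [t] has a marked place within [D]. Consecutive ones are at most
    [D + 1 + D] apart, within the range [L0] of the last rule, so decoded words concatenate along
    [t]. *)
Lemma reachable_translate t u i : supp phi (p.1 ++ t) -> (size u <= D)%N ->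
  entry y (p.1 ++ t ++ u, i) <> None ->
  exists a q, trace y p a = Some q /\ same phi q (p.1 ++ t ++ u, i).
Proof.
case ep : (entry y p) p_entry => [e|] // _.
elim/last_ind: t u i => [|t s IH] u i st su eu.
  have [_ _ _ R4] := rules_at ep; apply: R4 => //; apply: leq_trans su _; lia.
have st' : supp phi (p.1 ++ t).
  by move: st; rewrite -cats1 catA => /(supp_prefix mphi.1).
have [_ [_ _ /(_ _ st')[[d [d' [j [sd sd' ed edd']]]] _]]] := cQ.
have edd : equivalent_in phi ((p.1 ++ t) ++ (d ++ d')) (p.1 ++ t).
  by have := equivalent_in_catl lpH mphi edd'; rewrite cats0.
have [//|//||a [q [tq qd]]] := IH d j; first by rewrite catA.
have := entry_supp eu; rewrite /= -cats1 -!catA => seu.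
(* The detour [d ++ d'] to a marked place and back does not change the class. *)
have back : equivalent_in phi (p.1 ++ t ++ d ++ d' ++ [:: s] ++ u) (p.1 ++ t ++ [:: s] ++ u).
  have := @equivalent_in_catr _ lpH _ _ _ ([:: s] ++ u) mphi (equivalent_in_sym edd).
  by rewrite -!catA => /(_ seu) /equivalent_in_sym.
have eq : entry y q <> None by rewrite (entry_same qd) catA.
case eqe : (entry y q) eq => [e'|] // _.
have [_ _ _ R4] := rules_at eqe.
have sqd : same phi (q.1 ++ d' ++ [:: s] ++ u, i) (p.1 ++ t ++ rcons [::] s ++ u, i).
  split=> //; apply: (equivalent_in_trans _ back).
  case: qd => qd _; apply: equivalent_in_sym.
  have := @equivalent_in_catr _ lpH _ _ _ (d' ++ [:: s] ++ u) mphi (equivalent_in_sym qd).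
  by rewrite -!catA; apply; case: back.
(* Return by [d'], cross the edge [s], go out by [u]: the length is at most [2 * D + 1]. *)
have [||b [q' [tb qb]]] := R4 (d' ++ [:: s] ++ u) i.
- by rewrite !size_cat /=; lia.
- by rewrite (entry_same sqd) /=; move: eu; rewrite -cats1 -!catA.
exists (a ++ b), q'; split; first by rewrite trace_cat tq.
exact: same_trans qb sqd.
Qed.

End Base.

Hypothesis aper : strongly_aperiodic (subshift F).

Lemma decode_aperiodic w : supp phi w -> shift c w = c -> wclass w = wclass [::].
Proof.
move=> sw e; apply/wclass_eq.
have ephi : ashift phi w = phi by rewrite -{2}e.
have ey : (fun u => y (w ++ u)) = y by rewrite -{2}e.
have s0 : supp phi [::] by case: mphi => -[].
have [_ [_ _ /(_ _ s0)[[u [u' [i [su su' eu uu']]]] _]]] := cQ.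
have {}eu : entry y (u, i) <> None by [].
have {}uu' : equivalent_in phi (u ++ u') [::] by [].
(* Periodicity makes a place and its translate by [w] decode alike. *)
have decw : decode_state y (w ++ u, i) = decode_state y (u, i) /\
            decode_letter y (w ++ u, i) = decode_letter y (u, i).
  by have [] := decode_translate y w (u, i); rewrite ey.
have wu : equivalent_in phi (w ++ (u ++ u')) w.
  have := @equivalent_in_catl _ lpH phi w _ _ mphi.
  by rewrite ephi => /(_ _ _ uu'); rewrite cats0.
have ewu : entry y (w ++ u, i) <> None
  by rewrite -[entry _ _]/(entry (fun v => y (w ++ v)) (u, i)) ey.
have swu := entry_supp ewu.
(* Prefixing the loop [u ++ u'] presents the translate as a place reached from [u] along
   [u' ++ w]. *)
have home : equivalent_in phi (u ++ u' ++ w ++ u) (w ++ u).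
  rewrite catA -[X in equivalent_in _ _ X]cat0s; apply: equivalent_in_sym.
  by apply: equivalent_in_catr => //; exact: equivalent_in_sym.
have {home} home : same phi (u ++ (u' ++ w) ++ u, i) (w ++ u, i) by rewrite -catA.
have [||a [q [tq qe]]] := @reachable_translate (u, i) eu (u' ++ w) u i _ su.
- have := entry_supp (p := (u ++ (u' ++ w) ++ u, i)).
  by rewrite (entry_same home) => /(_ ewu) /=; rewrite catA => /(supp_prefix mphi.1).
- by rewrite (entry_same home).
have {qe home} qe := same_trans qe home.
have sa : supp (decode_state y (u, i)) a by apply/supp_traceP => //; exists q.
have [dq1 dq2] := decode_same qe; have [dc1 dc2] := decode_cat tq.
(* The word [a] leads from the place [(u, i)] to its translate by [w]. *)
have sh : shift (decode_state y (u, i), decode_letter y (u, i)) a =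
          (decode_state y (u, i), decode_letter y (u, i)).
  by congr pair; apply/funext => b /=; rewrite ?dc1 ?dc2 ?dq1 ?dq2 ?decw.1 ?decw.2.
have /wclass_eq a0 := aper (decode_subshift eu) sa sh.
have s00 : supp (decode_state y (u, i)) [::] by apply/supp_traceP => //; exists (u, i).
(* Since [a] is trivial, its trace ends at [(u, i)] as well as at the translate. So [w ++ u] is
   equivalent to [u], and appending [u'] removes [u] on both sides. *)
have [//|q1 [q2 [t1 t2 q12]]] := @decode_equivalent (u, i) eu a [::].
move: t1 t2 q12; rewrite tq => -[<-] [<-] q12.
have [wuu _] := same_trans (same_sym qe) q12.
rewrite /= in wuu.
have [_ _ h1] := wu; have [_ _ h2] := uu'.
apply: equivalent_trans (equivalent_sym h1) _; apply: equivalent_trans h2.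
have := @equivalent_in_catr _ lpH _ _ _ u' mphi wuu.
by rewrite -catA => -[|//]; case: wu.
Qed.

End Decoding.

(** * Existence of an encoded configuration *)

Section Encode.
Variables (G H : blueprint) (A : finType).
Hypotheses (finMG : finite_set [set: state G]) (finSG : finite_set [set: gen G]).
Hypothesis finSH : finite_set [set: gen H].
Hypotheses (lpG : locally_presented G) (lpH : locally_presented H).
Hypothesis scH : forall phi, models H phi -> word_connected phi.
Variables (K L D L0 : nat) (F : set (seq (gen G) -> option (state G * A))).
Local Notation index := (index finSG L).
Local Notation marking := (marking A finMG finSG finSH K L).
Local Notation cell := (cell A finMG finSG finSH K L).
Local Notation place := (place H finSG L).
Local Notation rules := (@rules G H A finMG finSG finSH K L D L0 F).
Variables (psi : seq (gen G) -> option (state G)) (x : seq (gen G) -> option A).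
Hypothesis Xpsi : subshift F (psi, x).
Variables (phi : seq (gen H) -> option (state H)).
Hypothesis mphi : models H phi.
Variable g : seq (gen G) -> seq (gen H).
Hypothesis g_supp : forall a, supp psi a -> supp phi (g a).
Hypothesis g_equiv : forall a b, equivalent_in psi a b -> g a = g b.
(** One word is fixed for each vertex in the image, so lying in the same fibre becomes equality of
    words. *)
Hypothesis g_canonical : forall a b, supp psi a -> supp psi b ->
  equivalent (g a) (g b) -> g a = g b.
Hypothesis g_step : forall a s, supp psi (rcons a s) -> reach phi K (g a) (g (rcons a s)).
Hypothesis g_proper : forall a b, supp psi a -> supp psi b ->
  reach phi L0 (g a) (g b) -> reach psi L a b.
Hypothesis g_dense : forall v, supp phi v ->
  exists a, [/\ supp psi a, reach phi D v (g a) & reach phi D (g a) v].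
Implicit Types (p q : place) (a b : seq (gen G)) (v w : seq (gen H)).

Let mpsi : models G psi. Proof. by case: Xpsi. Qed.
Let suppx : supp x = supp psi. Proof. by case: Xpsi => _ []. Qed.
Let x_equiv a b : equivalent_in psi a b -> x a = x b.
Proof. by case: Xpsi => _ [_ h _] [? ? ?]; exact: h. Qed.

Definition base v : seq (gen G) := some_in [::] [set b | supp psi b /\ g b = v].

Lemma base_g a : supp psi a -> supp psi (base (g a)) /\ g (base (g a)) = g a.
Proof. by move=> sa; apply: (@some_inP _ _ [set b | supp psi b /\ g b = g a]); exists a. Qed.

Definition label a : index :=
  some_in [bseq] [set t : index | equivalent_in psi (base (g a) ++ t) a].

(** Points of one fibre have images at distance 0, so [g_proper] joins the base point to [a] by a
    word short enough to be an [index]. *)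
Lemma labelP a : supp psi a -> equivalent_in psi (base (g a) ++ label a) a.
Proof.
move=> sa; apply: (@some_inP _ _ [set t : index | equivalent_in psi (base (g a) ++ t) a]).
have [sb eb] := base_g sa.
have [|t [st ht]] := g_proper sb sa; last by exists (Bseq st).
exists [::]; split=> //; rewrite cats0 eb; apply: equivalent_in_refl; exact: g_supp.
Qed.

Lemma label_equiv a b : equivalent_in psi a b -> label a = label b.
Proof.
move=> ab; rewrite /label (g_equiv ab); congr some_in; apply/seteqP; split=> t /= h.
  exact: equivalent_in_trans ab.
exact: equivalent_in_trans (equivalent_in_sym ab).
Qed.

Definition represents p a := [/\ supp psi a, equivalent_in phi (g a) p.1 & label a = p.2].

Lemma represents_equiv p a b : equivalent_in psi a b -> represents p a -> represents p b.
Proof.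
move=> ab [sa ga la]; split; first by case: ab.
  by rewrite -(g_equiv ab).
by rewrite -(label_equiv ab).
Qed.

(** Fibre and label determine the point: it is the base point followed by the label. *)
Lemma represents_inj p a b : represents p a -> represents p b -> equivalent_in psi a b.
Proof.
move=> [sa ga la] [sb gb lb].
have gab : g a = g b.
  by apply: g_canonical => //; have [] := equivalent_in_trans ga (equivalent_in_sym gb).
apply: equivalent_in_trans (labelP sb); rewrite -gab lb -la.
exact/equivalent_in_sym/labelP.
Qed.

Lemma represents_same p q a : same phi p q -> represents p a -> represents q a.
Proof.
move=> [e1 e2] [sa ga la]; split=> //; last by rewrite la.
exact: equivalent_in_trans e1.
Qed.

Definition displacement a s : K.-bseq (fin_of finSH) :=
  some_in [bseq] [set u : K.-bseq (fin_of finSH) |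
    equivalent_in phi (g a ++ (u : seq (gen H))) (g (rcons a s))].

Lemma displacementP a s : supp psi (rcons a s) ->
  equivalent_in phi (g a ++ displacement a s) (g (rcons a s)).
Proof.
move=> sas; apply: (@some_inP _ _ [set u : K.-bseq (fin_of finSH) |
  equivalent_in phi (g a ++ (u : seq (gen H))) (g (rcons a s))]).
by have [t [st ht]] := g_step sas; exists (Bseq st).
Qed.

Definition mark a : option marking :=
  if psi a is Some m then
    omap (fun l : A => (m, l, [ffun s : fin_of finSG =>
      (displacement a s, label (rcons a s))]) : marking) (x a)
  else None.

Definition encode v : option cell :=
  omap (fun=> [ffun i : index => if pselect (exists a, represents (v, i) a)
    then mark (some_in [::] [set a | represents (v, i) a]) else None] : cell) (phi v).

(** The marking is read off a chosen representative, which [represents_inj] shows equivalent to [a];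
    state, letter and successors therefore agree. *)
Lemma entry_represents p a : represents p a -> exists e, [/\ entry encode p = Some e,
  psi a = Some (marking_state e), x a = Some (marking_letter e)
  & forall s, supp psi (rcons a s) -> represents (p.1 ++ offset e s, target e s) (rcons a s)].
Proof.
case: p => v i pa; have [_ [_ sv _] _] := pa.
have pb : represents (v, i) (some_in [::] [set b | represents (v, i) b]).
  by apply: (@some_inP _ _ [set b | represents (v, i) b]); exists a.
set b := some_in _ _ in pb; have ab := represents_inj pa pb.
rewrite (equivalent_in_val mpsi ab) (x_equiv ab).
have [sb gb lb] := pb; have xb : supp x b by rewrite suppx.
have : entry encode (v, i) = mark b.
  rewrite /entry /encode /=; case ev: (phi v) => [m|] /=; last by case: sv.
  by rewrite ffunE; case: pselect => //= -[]; exists a.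
rewrite /mark; case: (psi b) (sb : psi b <> None) => // m _.
case: (x b) (xb : x b <> None) => // l _ /= ->.
eexists; split; [reflexivity|by []|by []|].
move=> s sas; have abs : equivalent_in psi (rcons b s) (rcons a s).
  rewrite -!cats1; apply: equivalent_in_sym.
  by apply: (equivalent_in_catr lpG mpsi ab); rewrite cats1.
apply: (represents_equiv abs); have [sbs _ _] := abs.
rewrite /offset /target /= ffunE /=; split=> //=.
apply: equivalent_in_sym.
have dP := displacementP sbs.
apply: equivalent_in_trans dP; apply: equivalent_in_sym.
by apply: (equivalent_in_catr lpH mphi gb); case: (displacementP sbs).
Qed.

Lemma entry_encode p e : entry encode p = Some e -> exists a, represents p a.
Proof.
case: p => v i; rewrite /entry /encode /=; case: (phi v) => //= m; rewrite ffunE.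
by case: pselect.
Qed.

Lemma step_represents p a s : represents p a ->
  if step encode p s is Some q then represents q (rcons a s) else ~ supp psi (rcons a s).
Proof.
move=> pa; have [e [pe ea _ h]] := entry_represents pa; rewrite /step pe.
have sP := supp_rconsP a s mpsi.1.
case: asboolP => es; first by apply: h; apply/sP; rewrite ea es.
by move=> /sP; rewrite ea => -[].
Qed.

Lemma trace_represents p a b : represents p a ->
  if trace encode p b is Some q then represents q (a ++ b) else ~ supp psi (a ++ b).
Proof.
elim: b p a => [|s b IH] p a pa /=; first by rewrite cats0.
have := step_represents s pa; rewrite -cat1s catA cats1.
case: step => [q /IH|] //= h; apply: contra_not h; apply: supp_prefix; exact: mpsi.1.
Qed.

Lemma decode_represents p a b : represents p a ->
  decode_state encode p b = psi (a ++ b) /\ decode_letter encode p b = x (a ++ b).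
Proof.
move=> /(trace_represents b); rewrite /decode_state /decode_letter.
case: trace => [q|] /= h; first by have [e [-> -> -> _]] := entry_represents h.
by rewrite (supp_None h) supp_None// suppx.
Qed.

Lemma encode_equiv v w : equivalent_in phi v w -> encode v = encode w.
Proof.
move=> vw; rewrite /encode (equivalent_in_val mphi vw); case: (phi w) => //= _.
congr Some; apply/ffunP => i; rewrite !ffunE.
rewrite (_ : represents (v, i) = represents (w, i))//; apply/seteqP; split=> a.
  exact: represents_same.
by apply: represents_same; split=> //=; exact: equivalent_in_sym.
Qed.

Lemma encode_rules v : supp phi v -> rules (shift (phi, encode) v).
Proof.
move=> sv; split.
  have [a [sa [u [su vu]] [u' [su' gu]]]] := g_dense sv.
  exists u, u', (label a); split=> //.
    have [|e [ee _ _ _]] := @entry_represents (v ++ u, label a) a.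
      by split=> //=; exact: equivalent_in_sym.
    by rewrite -[entry _ _]/(entry encode (v ++ u, label a)) ee.
  (* The rule concerns the model shifted by [v]; the loop known in [phi] passes to it by left
     cancellation. *)
  apply: (equivalent_in_cancel lpH scH mphi); rewrite cats0 catA.
  apply: (equivalent_in_trans _ gu); apply: equivalent_in_sym.
  by apply: (equivalent_in_catr lpH mphi (equivalent_in_sym vu)); case: gu.
move=> i e0 ee0.
have ev : (v, i) = translate v ([::], i) by rewrite /translate /= cats0.
have {}ee0 : entry encode (v, i) = Some e0 by rewrite ev.
have [a va] := entry_encode ee0.
have [e [ee ea xa h]] := entry_represents va.
have {ee} e0e : e0 = e by move: ee; rewrite ee0 => -[].
rewrite {}e0e in ee0 *.
have traceE b : omap (translate v) (trace (shift (phi, encode) v).2 ([::], i) b) =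
    trace encode (v, i) b by rewrite ev trace_translate.
have tr b q : trace (shift (phi, encode) v).2 ([::], i) b = Some q ->
    represents (translate v q) (a ++ b).
  move=> t; have := trace_represents b va; rewrite -traceE t; exact.
have back q q' : same phi (translate v q) (translate v q') -> same (ashift phi v) q q'.
  by move=> [e1 e2]; split=> //; exact: (equivalent_in_cancel lpH scH mphi e1).
split.
- move=> s es.
  have psis : psi a = Some (ini s) by rewrite ea es.
  have [m tm pm] := (mpsi.1.2 a s).1 psis.
  have sas : supp psi (rcons a s) by rewrite /supp /= pm.
  have qa := h _ sas; set q := (_, _) in qa.
  have [e' [ee' ea' _ _]] := entry_represents qa.
  exists (offset e s, target e s), e'; split; last by move: ea'; rewrite pm => -[<-].
    rewrite /step (_ : entry _ _ = Some e); first by case: asboolP.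
    by rewrite -[entry _ _]/(entry encode (translate v ([::], i))) -ev.
  by rewrite -[entry _ _]/(entry encode q).
- move=> r r' q q' rr /tr qa /tr qa'; apply: back.
  have [sr _ _] := qa; have [sr' _ _] := qa'.
  (* Both sides of a relation lead from [a] to the same vertex over [psi], hence to the same image
     and label. *)
  have arr : equivalent_in psi (a ++ r) (a ++ r').
    split=> //; apply: rst_step; split;
      [exact: supp_consistent mpsi.1 sr|exact: supp_consistent mpsi.1 sr'|].
    by exists a, [::], r, r'; rewrite !cats0.
  have [_ g1 l1] := represents_equiv arr qa; have [_ g2 l2] := qa'.
  split; last by rewrite -l1 -l2.
  exact: equivalent_in_trans (equivalent_in_sym g1) g2.
- move=> f Ff; have [sa _ _] := va.
  have [_ [_ _ /(_ f a Ff sa)[u [m [l [fu ne]]]]]] := Xpsi.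
  exists u, m, l; split=> //.
  have [<- <-] := decode_translate encode v ([::], i).
  by rewrite -ev; have [-> ->] := decode_represents u va.
- move=> u j su; rewrite -[entry _ _]/(entry encode (v ++ u, j)).
  case eu: entry => [e'|] // _ svu; have [b vb] := entry_encode eu.
  have [sa ga la] := va; have [sb gb lb] := vb.
  (* Nearby marked places represent points whose images are at distance at most [L0]; properness
     joins these points by a word of length at most [L]. *)
  have [|t [st tb]] := g_proper sa sb.
    exists u; split=> //; apply: equivalent_in_trans (equivalent_in_sym gb).
    apply: equivalent_in_sym; apply: (equivalent_in_catr lpH mphi) => //.
    exact: equivalent_in_sym.
  have := trace_represents t va; rewrite -traceE.
  case tq: trace => [q|] /=; last by case: tb.
  move=> /(represents_equiv tb) [_ gq lq]; exists t, q; split=> //.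
  apply: back; split; last by rewrite -lq -lb.
  exact: equivalent_in_trans (equivalent_in_sym gq) gb.
Qed.

Lemma encode_subshift : local_subshift rules (phi, encode).
Proof.
split=> //; split=> /= [|v w sv sw vw|v]; last exact: encode_rules.
  by apply/seteqP; split=> v; rewrite /supp /= /encode; case: (phi v).
by apply: encode_equiv.
Qed.

End Encode.

(** * Transfer along a quasi-isometry *)

Lemma finite_bounded T (X : set T) (f : T -> nat) : finite_set X ->
  exists n, forall t, X t -> (f t <= n)%N.
Proof.
move=> /(finite_image f)/finite_seqP[s e]; exists (\max_(i <- s) i)%N => t Xt.
have : (f @` X) (f t) by exists t.
by rewrite e /= => fs; exact: (leq_bigmax_seq (F := id)).
Qed.

Section Transfer.
Variables (G H : blueprint) (A : finType).
Hypotheses (fpG : finitely_presented G) (fpH : finitely_presented H).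
Hypotheses (lpG : locally_presented G) (lpH : locally_presented H).
Hypotheses (scG : strongly_connected G) (scH : strongly_connected H).
Variable F : set (seq (gen G) -> option (state G * A)).
Hypotheses (F_pattern : F `<=` @pattern G A) (F_finite : finite_set F).
Hypothesis aper : strongly_aperiodic (subshift F).
Variables (psi : seq (gen G) -> option (state G)) (x : seq (gen G) -> option A).
Hypothesis Xpsi : subshift F (psi, x).
Variables (phi : seq (gen H) -> option (state H)).
Hypothesis mphi : models H phi.
Variables (N : nat) (f : vertex (model_graph psi) -> vertex (model_graph phi)).
Hypothesis qi : nat_qi N f.

Let mpsi : models G psi. Proof. by case: Xpsi. Qed.
Let reach_dist n u v (su : supp psi u) (sv : supp psi v) :
  (dist (vertex_of su) (vertex_of sv) <= n)%N <-> reach psi n u v.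
Proof.
have hu := repr_vertex_of su; have hv := repr_vertex_of sv.
rewrite (dist_reach lpG mpsi (scG mpsi)); split; first exact: reach_equivalent.
by apply: reach_equivalent => //; exact: equivalent_in_sym.
Qed.

Definition word_map (a : seq (gen G)) : seq (gen H) :=
  if pselect (supp psi a) is left sa then repr (f (vertex_of sa)) else [::].

Lemma word_mapE a (sa : supp psi a) : word_map a = repr (f (vertex_of sa)).
Proof.
rewrite /word_map; case: pselect => // sa'.
by congr (repr (f _)); exact: val_inj.
Qed.

(** [D] is the density constant and [L0] the gap between marked places of adjacent vertices. [L]
    comes from the lower quasi-isometry bound at distance [L0], and [K] from the upper bound at
    distance 1. *)
Let D := N.
Let L0 := (2 * D + 1)%N.
Let L := (N * (L0 + N))%N.
Let K := (N * 1 + N)%N.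
Local Notation g := word_map.

Let g_supp a : supp psi a -> supp phi (g a).
Proof. by move=> sa; rewrite (word_mapE sa); exact: (reprP _).1. Qed.

Let g_equiv a b : equivalent_in psi a b -> g a = g b.
Proof.
move=> [sa sb ab]; rewrite (word_mapE sa) (word_mapE sb); congr (repr (f _)).
by apply: val_inj; exact/wclass_eq.
Qed.

Let g_canonical a b : supp psi a -> supp psi b -> equivalent (g a) (g b) -> g a = g b.
Proof. by move=> sa sb; rewrite (word_mapE sa) (word_mapE sb) => /eq_repr ->. Qed.

Let g_step a s : supp psi (rcons a s) -> reach phi K (g a) (g (rcons a s)).
Proof.
move=> sas; have sa : supp psi a by move: sas; rewrite -cats1 => /(supp_prefix mpsi.1).
rewrite (word_mapE sa) (word_mapE sas); apply/(dist_reach lpH mphi (scH mphi)).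
have [h _ _] := qi; apply: leq_trans (h _ _) _; rewrite leq_add2r leq_mul2l.
apply/orP; right; apply/reach_dist; exists [:: s]; split=> //.
by rewrite cats1; exact: equivalent_in_refl.
Qed.

Let g_proper a b : supp psi a -> supp psi b ->
  reach phi L0 (g a) (g b) -> reach psi L a b.
Proof.
move=> sa sb; rewrite (word_mapE sa) (word_mapE sb).
move=> /(dist_reach lpH mphi (scH mphi)) h; apply/(reach_dist _ sa sb).
have [_ h' _] := qi; apply: leq_trans (h' _ _) _.
by rewrite leq_mul2l leq_add2r h orbT.
Qed.

Let g_dense v : supp phi v ->
  exists a, [/\ supp psi a, reach phi D v (g a) & reach phi D (g a) v].
Proof.
move=> sv; have [_ _ /(_ (vertex_of sv))[z [h1 h2]]] := qi.
have [sz ez] := reprP z; exists (repr z).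
have -> : g (repr z) = repr (f z).
  by rewrite (word_mapE sz); congr (repr (f _)); exact: val_inj.
have e := repr_vertex_of sv; have [sfz _] := reprP (f z).
have e' := equivalent_in_refl sfz.
move: h1 h2 => /(dist_reach lpH mphi (scH mphi)) h1 /(dist_reach lpH mphi (scH mphi)) h2.
by split=> //; [exact: reach_equivalent h1|exact: reach_equivalent h2].
Qed.

Lemma admits_transfer : admits_strongly_aperiodic_SFT H.
Proof.
have [finMG finSG finRG] := fpG; have [finMH finSH _] := fpH.
have wcH phi' : models H phi' -> word_connected phi'.
  by move=> m; exact: (strongly_connected_words lpH m (scH m)).
have [n1 hn1] := finite_bounded (fun r => size r.1 + size r.2)%N finRG.
have [h hP] : exists h, forall p, F p -> forall u, supp p u -> (size u <= h p)%N.
  suff : forall p, exists n, F p -> forall u, supp p u -> (size u <= n)%N.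
    by move=> /choice[h hP]; exists h.
  move=> p; have [Fp|nF] := pselect (F p); last by exists 0%N.
  by have [n hn] := finite_bounded size (F_pattern Fp); exists n.
have [n2 hn2] := finite_bounded h F_finite.
(* Here [n1] bounds the relations of [G], [n2] the supports of the patterns, and [L] the connecting
   words. *)
have loc : local (K * (n1 + n2 + L) + K + L0 + 2 * D)
    (@rules G H A finMG finSG finSH K L D L0 F).
  apply: rules_local; last by lia.
    by move=> r r' /hn1 /= hr; lia.
  move=> p u Fp su; have := hP _ Fp _ su; have := hn2 _ Fp; lia.
exists (cell A finMG finSG finSH K L).
exists (local_subshift (@rules G H A finMG finSG finSH K L D L0 F)).
split.
- exact: local_subshift_SFT loc.
- exists (phi, encode finMG finSG finSH K L psi x phi g).
  exact: encode_subshift.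
- by move=> c w cX; apply: (decode_aperiodic lpG lpH _ cX).
Qed.

End Transfer.

Theorem theorem2 (R : realType) (Gam1 Gam2 : blueprint)
  (fp1 : finitely_presented Gam1) (fp2 : finitely_presented Gam2)
  (sc1 : strongly_connected Gam1) (sc2 : strongly_connected Gam2)
  (lp1 : locally_presented Gam1) (lp2 : locally_presented Gam2)
  (nonempty_models : models Gam1 !=set0 <-> models Gam2 !=set0)
  (qi : quasi_isometric_blueprints R Gam1 Gam2) :
  admits_strongly_aperiodic_SFT Gam1 <-> admits_strongly_aperiodic_SFT Gam2.
Proof.
split=> -[A [_ [[F [Fp Ffin ->]] [[psi x] Xpsi] aper]]].
  (* Quasi-isometry of blueprints says nothing without models, so a model of [Gam2] is taken from
     [nonempty_models]. *)
  have [phi mphi] : models Gam2 !=set0 by apply/nonempty_models; exists psi; case: Xpsi.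
  have [N [f Nf]] := quasi_isometric_nat (qi _ _ Xpsi.1 mphi).
  exact: (admits_transfer fp1 fp2 lp1 lp2 sc1 sc2 Fp Ffin aper Xpsi mphi Nf).
have [phi mphi] : models Gam1 !=set0 by apply/nonempty_models; exists psi; case: Xpsi.
have [N [f Nf]] := quasi_isometric_nat (qi _ _ mphi Xpsi.1).
(* The transfer needs a map out of the graph that carries the given SFT, hence the inverse
   quasi-isometry. *)
have [N' [h Nh]] := nat_qi_inverse (sc2 _ Xpsi.1) Nf.
exact: (admits_transfer fp2 fp1 lp2 lp1 sc2 sc1 Fp Ffin aper Xpsi mphi Nh).
Qed.
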